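(* Suppose that $1$ is not an eigenvalue of the linear operator $\mathcal{K}$. Then the operator $\mathcal{I}-\mathcal{K}$ is invertible, and for each $l=1,2,\dots,L-1$ the approximate solutions $y_l^*$ produced by the continuous multi-grade deep learning model satisfy $$\|y-y_{l+1}^*\|_2\le c\,\|y-y_l^*\|_2,\qquad c:=\|(\mathcal{I}-\mathcal{K})^{-1}\|\,\|\mathcal{I}-\mathcal{K}\|.$$
   Context: Let $I:=[-1,1]$, let $C(I)$ be the space of continuous complex-valued functions on $I$, and $\|g\|_2:=(\int_I|g(s)|^2ds)^{1/2}$. Let $\kappa\ge 1$, let $K$ be a continuous complex-valued function on $I^2$, and $f\in C(I)$. Define $(\mathcal{K}h)(s):=\int_I K(s,t)e^{i\kappa|s-t|}h(t)\,dt$ for $h\in C(I)$, $s\in I$; $\mathcal{I}$ is the identity operator on $C(I)$. The function $y\in C(I)$ is the solution of $(\mathcal{I}-\mathcal{K})y=f$. Operator norms are those induced by $\|\cdot\|_2$. For a function $u=[u_1,u_2]^T$ with $u_1,u_2$ real-valued on $I$, $\mathcal{T}u:=u_1+iu_2$. Let $\sigma:\mathbb{R}\to\mathbb{R}$ be a continuous activation function, applied componentwise to vectors. For weight matrices $\mathbf{W}_j$ and bias vectors $\mathbf{b}_j$ of compatible sizes and an input vector $x$, let $\mathcal{F}_k(\{\mathbf{W}_j,\mathbf{b}_j\}_{j=1}^k;x)$ be the result of applying to $x$ successively the maps $v\mapsto\sigma(\mathbf{W}_jv+\mathbf{b}_j)$, $j=1,\dots,k$ (the identity if $k=0$), and let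 $\mathcal{N}_n(\{\mathbf{W}_j,\mathbf{b}_j\}_{j=1}^n;x):=\mathbf{W}_n\mathcal{F}_{n-1}(\{\mathbf{W}_j,\mathbf{b}_j\}_{j=1}^{n-1};x)+\mathbf{b}_n$. Continuous multi-grade deep learning model: let $L$ and $n_1,\dots,n_L$ be positive integers, and let $m_{l,j}$ ($1\le l\le L$, $0\le j\le n_l$) be positive integers with $m_{1,0}=1$, $m_{l,n_l}=2$, and $m_{l+1,0}=m_{l,n_l-1}$. Put $\mathbf{g}_0(s):=s$ and $y_0^*:=0$. Recursively for $l=1,\dots,L$: for $\theta=\{\mathbf{W}_j,\mathbf{b}_j\}_{j=1}^{n_l}$ with $\mathbf{W}_j\in\mathbb{R}^{m_{l,j}\times m_{l,j-1}}$, $\mathbf{b}_j\in\mathbb{R}^{m_{l,j}}$, set $$e_l(\theta;s):=\big(f-(\mathcal{I}-\mathcal{K})(y_{l-1}^*+\mathcal{T}\mathcal{N}_{n_l}(\theta;\mathbf{g}_{l-1}(\cdot)))\big)(s),\quad s\in I;$$ let $\{\mathbf{W}_{l,j}^*,\mathbf{b}_{l,j}^*\}_{j=1}^{n_l}$ be a minimizer of $\|e_l(\theta;\cdot)\|_2^2$ over all such $\theta$ (existence of minimizers is assumed throughout); set $\mathbf{g}_l(s):=\mathcal{F}_{n_l-1}(\{\mathbf{W}_{l,j}^*,\mathbf{b}_{l,j}^*\}_{j=1}^{n_l-1};\mathbf{g}_{l-1}(s))$, $\mathbf{f}_l(s):=\mathbf{W}_{l,n_l}^*\mathbf{g}_l(s)+\mathbf{b}_{l,n_l}^*$,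 $y_l^*:=\sum_{j=1}^l\mathcal{T}\mathbf{f}_j$, and $e_l^*(s):=e_l(\{\mathbf{W}_{l,j}^*,\mathbf{b}_{l,j}^*\}_{j=1}^{n_l};s)$. *)

(* Defs.v *)
From HB Require Import structures.
From mathcomp Require Import all_boot all_order all_algebra.
From mathcomp Require Import all_classical all_reals all_analysis.
From mathcomp Require Import complex.

Set Implicit Arguments.
Unset Strict Implicit.
Unset Printing Implicit Defensive.

Import Order.TTheory GRing.Theory Num.Theory.
Import numFieldNormedType.Exports.

Local Open Scope classical_set_scope.
Local Open Scope ring_scope.
Local Open Scope complex_scope.

(* Functions on I = [-1, 1] are represented by functions on R; their values
   outside I are irrelevant, so equalities between them are stated on I only. *)

Section Operators.
Variable R : realType.
Implicit Types (g h : R -> R[i]) (A S : (R -> R[i]) -> R -> R[i]).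

Definition I11 : set R := `[-1, 1].

(* R[i]^o is the type of complex numbers with the topology of its modulus. *)
Definition CI h : Prop := {within I11, continuous (h : R -> R[i]^o)}.

Definition CI2 (K : R -> R -> R[i]) : Prop :=
  {within I11 `*` I11, continuous (fun p : R * R => K p.1 p.2 : R[i]^o)}.

Definition cintegral h : R[i] :=
  (\int[lebesgue_measure]_(t in I11) complex.Re (h t))
    +i* (\int[lebesgue_measure]_(t in I11) complex.Im (h t)).

Definition norm2 g : R :=
  Num.sqrt (\int[lebesgue_measure]_(s in I11) (Normc.normc (g s) ^+ 2)).

Definition expi (x : R) : R[i] := cos x +i* sin x.

Definition calK (kappa : R) (K : R -> R -> R[i]) h : R -> R[i] :=
  fun s => cintegral (fun t => K s t * expi (kappa * `|s - t|) * h t).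

Definition id_sub A h : R -> R[i] := fun s => h s - A h s.

Definition is_eigenvalue A (lambda : R[i]) : Prop :=
  exists h, [/\ CI h, (exists2 s, I11 s & h s != 0)
              & forall s, I11 s -> A h s = lambda * h s].

Definition opnorm A : \bar R :=
  ereal_sup [set (norm2 (A h) / norm2 h)%:E | h in [set h | CI h /\ 0 < norm2 h]].

(* A and S are mutually inverse maps of C(I), both of finite operator norm. *)
Definition is_bounded_inverse A S : Prop :=
  [/\ (forall h, CI h -> CI (A h) /\ CI (S h)),
      (forall h, CI h -> forall s, I11 s -> S (A h) s = h s),
      (forall h, CI h -> forall s, I11 s -> A (S h) s = h s),
      opnorm A \is a fin_num
    & opnorm S \is a fin_num].

End Operators.

Section Networks.
Variable R : realType.
Variable sigma : R -> R.

(* Weights and biases of a network of layer widths d 0, d 1, ...: entry j holds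
   (W_{j+1}, b_{j+1}).  A network of depth n only uses the entries j < n. *)
Definition params (d : nat -> nat) : Type :=
  forall j : nat, 'M[R]_(d j.+1, d j) * 'cV[R]_(d j.+1).

Fixpoint hidden (d : nat -> nat) (theta : params d) (x : 'cV[R]_(d 0)) (k : nat)
    : 'cV[R]_(d k) :=
  match k with
  | 0 => x
  | k'.+1 => map_mx sigma ((theta k').1 *m hidden theta x k' + (theta k').2)
  end.

(* The affine output layer is not activated; the depth n is positive in use. *)
Definition network (d : nat -> nat) (theta : params d) (x : 'cV[R]_(d 0)) (n : nat)
    : 'cV[R]_(d n) :=
  match n with
  | 0 => x
  | n'.+1 => (theta n').1 *m hidden theta x n' + (theta n').2
  end.

(* conform_mx recasts u to the type 'cV_2; it is the identity on entries when
   k = 2, the only case that is used. *)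
Definition calT (k : nat) (u : 'cV[R]_k) : R[i] :=
  let v : 'cV[R]_2 := conform_mx 0 u in v 0 0 +i* v 1 0.

End Networks.

Section MultiGrade.
Variable R : realType.
Variables (kappa : R) (K : R -> R -> R[i]) (f : R -> R[i]) (sigma : R -> R).
(* Grade l >= 1 has depth n l and widths m l 0, ..., m l (n l); theta l holds
   the parameters selected in grade l (theta 0 is unused). *)
Variables (n : nat -> nat) (m : nat -> nat -> nat).
Variable theta : forall l, params R (m l).

(* The feature map g_l, which is the input of grade l.+1.  conform_mx recasts
   from width m l (n l).-1 to width m l.+1 0, assumed equal for 1 <= l < L. *)
Fixpoint feature (l : nat) (s : R) : 'cV[R]_(m l.+1 0) :=
  match l with
  | 0 => const_mx s
  | l'.+1 => conform_mx 0 (hidden sigma (theta l'.+1) (feature l' s) (n l'.+1).-1)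
  end.

(* T N_{n_{l+1}}(theta'; g_l(s)), the output of grade l.+1 for parameters theta'.
   At the selected parameters this is (T f_{l+1})(s). *)
Definition grade_output (l : nat) (theta' : params R (m l.+1)) (s : R) : R[i] :=
  calT (network sigma theta' (feature l s) (n l.+1)).

Definition ystar (l : nat) (s : R) : R[i] :=
  \sum_(j < l) grade_output (theta j.+1) s.

(* The error e_{l+1}(theta'; s) of grade l.+1. *)
Definition grade_error (l : nat) (theta' : params R (m l.+1)) (s : R) : R[i] :=
  f s - id_sub (calK kappa K) (fun t => ystar l t + grade_output theta' t) s.

(* theta is a selection of minimizers for the grades 1, ..., L. *)
Definition mgdl_minimizers (L : nat) : Prop :=
  forall l, (l < L)%N -> forall theta' : params R (m l.+1),
    norm2 (grade_error (theta l.+1)) ^+ 2 <= norm2 (grade_error theta') ^+ 2.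

End MultiGrade.

Definition mgdl_architecture (L : nat) (n : nat -> nat) (m : nat -> nat -> nat)
    : Prop :=
  [/\ (0 < L)%N,
      (forall l, (1 <= l <= L)%N ->
         (0 < n l)%N /\ forall j, (j <= n l)%N -> (0 < m l j)%N),
      m 1 0 = 1%N,
      (forall l, (1 <= l <= L)%N -> m l (n l) = 2%N)
    & (forall l, (1 <= l < L)%N -> m l.+1 0 = m l (n l).-1)].

(* Main.v *)
Require Import Defs.
From HB Require Import structures.
From mathcomp Require Import all_boot all_order all_algebra.
From mathcomp Require Import all_classical all_reals all_analysis.
From mathcomp Require Import complex.
From mathcomp Require Import ring lra.

Set Implicit Arguments.
Unset Strict Implicit.
Unset Printing Implicit Defensive.

Import Order.TTheory GRing.Theory Num.Theory.
Import numFieldNormedType.Exports.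

Local Open Scope classical_set_scope.
Local Open Scope ring_scope.
Local Open Scope complex_scope.

(** The estimate itself is short. Write A for the operator id - calK and y_l
    for the l-th approximation. Because A y = f, the error of grade l+1 at the
    selected parameters is A (y - y_{l+1}), and at the parameters that are all
    zero, where the network vanishes, it is A (y - y_l). Minimality thus gives
    |A (y - y_{l+1})| <= |A (y - y_l)| in the 2-norm, and the claim follows by
    applying the inverse S of A on the left and the operator norm of A on the
    right.

    What takes work is that A is invertible on C(I) with an inverse that is
    bounded for the 2-norm. This is the Fredholm alternative, proved here from
    two properties of a kernel operator T ([smoothing]): T h is bounded by a
    multiple of the 2-norm of h, and the functions T h are equicontinuous,
    with a modulus proportional to that norm. Equicontinuity lets one
    interpolate: with a partition of unity phi_i subordinate to a fine grid
    p_i, the finite rank operator D h = sum_i (T h)(p_i) phi_i differs from T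
    by an operator E as small as one wants ([finite_rank_approximation]). Then
    id - E is inverted by its Neumann series ([neumann_inverse]), and solving
    h - T h = g reduces to a square linear system for the numbers (T h)(p_i);
    its matrix is invertible because a kernel vector would give an
    eigenfunction of T for the eigenvalue 1 ([fredholm_alternative]). The
    2-norm bound is read off the construction.

    Only finiteness of the operator norms matters, so constants are crude
    throughout: each triangle inequality or comparison of norms may lose a
    factor 2, which the smallness 1/8 of E absorbs. *)

Import Normc.

(** * The modulus and continuity of complex-valued functions *)

Section ComplexContinuity.
Variable R : realType.
Implicit Types (z w : R[i]).

Lemma normc_ge0 z : 0 <= normc z.
Proof. by case: z => a b; exact: sqrtr_ge0. Qed.

Lemma normcD z w : normc (z + w) <= normc z + normc w.
Proof. exact: (@le_normcD R). Qed.

Lemma normc_opp z : normc (- z) = normc z.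
Proof. exact: (@normcN R). Qed.

Lemma normcB_sym z w : normc (z - w) = normc (w - z).
Proof. by rewrite -normc_opp opprB. Qed.

Lemma sqr_normcE z : normc z ^+ 2 = complex.Re z ^+ 2 + complex.Im z ^+ 2.
Proof. by case: z => a b; rewrite /= sqr_sqrtr// addr_ge0// sqr_ge0. Qed.

Lemma ler_Re_normc z : `|complex.Re z| <= normc z.
Proof.
by case: z => a b /=; rewrite -sqrtr_sqr ler_sqrt ?lerDl ?addr_ge0 ?sqr_ge0.
Qed.

Lemma ler_Im_normc z : `|complex.Im z| <= normc z.
Proof.
by case: z => a b /=; rewrite -sqrtr_sqr ler_sqrt ?lerDr ?addr_ge0 ?sqr_ge0.
Qed.

Lemma ler_normc_ReIm z : normc z <= `|complex.Re z| + `|complex.Im z|.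
Proof.
rewrite -(@ler_pXn2r _ 2) ?nnegrE ?normc_ge0 ?addr_ge0// sqr_normcE.
rewrite -(real_normK (num_real (complex.Re z))).
rewrite -(real_normK (num_real (complex.Im z))).
have := normr_ge0 (complex.Re z); have := normr_ge0 (complex.Im z); nra.
Qed.

Lemma normc_real (x : R) : normc x%:C = `|x|.
Proof. by rewrite /= expr0n addr0 sqrtr_sqr. Qed.

Lemma ler_dist_normc z w : `|normc z - normc w| <= normc (z - w).
Proof.
rewrite ler_norml; apply/andP; split.
  by have := normcD (w - z) z; rewrite subrK normcB_sym; lra.
by have := normcD (z - w) w; rewrite subrK; lra.
Qed.

Lemma normc_sum (I : Type) (r : seq I) (F : I -> R[i]) :
  normc (\sum_(i <- r) F i) <= \sum_(i <- r) normc (F i).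
Proof.
elim: r => [|i r IH]; first by rewrite !big_nil normc0.
by rewrite !big_cons (le_trans (normcD _ _))// lerD2l.
Qed.

(** The topology of [R[i]^o] is given by balls whose radii are positive elements
    of [R[i]]; such a radius is real, so real radii suffice. *)
Lemma cvg_normcP (T : Type) (F : set_system T) (FF : Filter F) (f : T -> R[i]^o)
    (l : R[i]^o) :
  f @ F --> l <-> forall e : R, 0 < e -> \forall t \near F, normc (l - f t) < e.
Proof.
split=> [/cvgrPdist_lt fl e e0|fl].
  have := fl e%:C; rewrite ltcR => /(_ e0).
  by apply: filterS => t; rewrite /= -ltcR.
apply/cvgrPdist_lt => -[e e'] /=; rewrite ltcE/= => /andP[/eqP/= -> e0].
by apply: filterS (fl e e0) => t; rewrite -ltcR.
Qed.

Lemma continuous_dominated (T : topologicalType) (f : T -> R[i]^o)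
    (g : T -> R^o) :
  (forall s t, `|g s - g t| <= normc (f s - f t)) ->
  continuous f -> continuous g.
Proof.
move=> gf cf x; apply/cvgrPdist_lt => e e0.
have /cvg_normcP /(_ _ e0) := cf x.
by apply: filterS => t; apply: le_lt_trans; exact: gf.
Qed.

Lemma continuous_Re (T : topologicalType) (f : T -> R[i]^o) :
  continuous f -> continuous (fun t => complex.Re (f t) : R^o).
Proof.
apply: continuous_dominated => s t; apply: le_trans (ler_Re_normc _).
by case: (f s) (f t) => a b [].
Qed.

Lemma continuous_Im (T : topologicalType) (f : T -> R[i]^o) :
  continuous f -> continuous (fun t => complex.Im (f t) : R^o).
Proof.
apply: continuous_dominated => s t; apply: le_trans (ler_Im_normc _).
by case: (f s) (f t) => a b [].
Qed.

Lemma continuous_normc (T : topologicalType) (f : T -> R[i]^o) :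
  continuous f -> continuous (fun t => normc (f t) : R^o).
Proof. by apply: continuous_dominated => s t; exact: ler_dist_normc. Qed.

Lemma continuous_Complex (T : topologicalType) (f g : T -> R^o) :
  continuous f -> continuous g ->
  continuous (fun t => f t +i* g t : R[i]^o).
Proof.
move=> cf cg x; apply/cvg_normcP => e e0.
have e20 : 0 < e / 2 by rewrite divr_gt0.
have /cvgrPdist_lt /(_ _ e20) F := cf x.
have /cvgrPdist_lt /(_ _ e20) G := cg x.
apply: filterS2 F G => t F G.
rewrite -[X in normc X]/((f x - f t) +i* (g x - g t)).
apply: (le_lt_trans (ler_normc_ReIm _)) => /=; rewrite (splitr e); exact: ltrD.
Qed.

End ComplexContinuity.

(** * Continuous functions on the interval *)

Section ContinuousFunctions.
Variable R : realType.
Implicit Types (f g h : R -> R[i]).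
Local Notation mu := (@lebesgue_measure R).

Lemma CI_epsP h : CI h <-> forall s, I11 s -> forall e : R, 0 < e ->
  exists2 d : R, 0 < d &
    forall t, I11 t -> `|t - s| < d -> normc (h t - h s) < e.
Proof.
split=> [/subspace_continuousP ch s Is e e0|H].
  have /cvg_normcP /(_ _ e0) := ch s Is.
  rewrite near_withinE => /nbhs_ballP[d /= d0 dP]; exists d => // t It ts.
  by rewrite normcB_sym; apply: dP => //; rewrite /ball/= distrC.
apply/subspace_continuousP => s Is; apply/cvg_normcP => e e0.
rewrite near_withinE; have [d d0 dP] := H s Is e e0.
apply/nbhs_ballP; exists d => //= t ts It.
by rewrite normcB_sym; apply: dP => //; rewrite distrC.
Qed.

Lemma CI_cst (c : R[i]) : CI (fun=> c).
Proof. by move=> x; exact: cvg_cst. Qed.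

Lemma CI_D f g : CI f -> CI g -> CI (fun s => f s + g s).
Proof. by move=> cf cg x; apply: (@cvgD _ R[i]^o); [exact: cf|exact: cg]. Qed.

Lemma CI_M f g : CI f -> CI g -> CI (fun s => f s * g s).
Proof. by move=> cf cg x; apply: (@cvgM R[i]); [exact: cf|exact: cg]. Qed.

Lemma CI_B f g : CI f -> CI g -> CI (fun s => f s - g s).
Proof. by move=> cf cg x; apply: (@cvgB _ R[i]^o); [exact: cf|exact: cg]. Qed.

Lemma CI_sum (I : Type) (r : seq I) (F : I -> R -> R[i]) :
  (forall i, CI (F i)) -> CI (fun s => \sum_(i <- r) F i s).
Proof.
move=> cF; elim: r => [|i r IH].
  under [X in CI X]funext => s do rewrite big_nil.
  exact: CI_cst.
under [X in CI X]funext => s do rewrite big_cons.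
by apply: CI_D; [exact: cF|exact: IH].
Qed.

Lemma CI_Complex (f g : R -> R) : continuous (f : R -> R^o) ->
  continuous (g : R -> R^o) -> CI (fun s => f s +i* g s).
Proof.
move=> cf cg; apply: continuous_subspaceT; exact: continuous_Complex.
Qed.

Lemma compact_I11 : compact (@I11 R). Proof. exact: segment_compact. Qed.

Lemma measurable_I11 : measurable (@I11 R). Proof. exact: measurable_itv. Qed.

Lemma integrable_I11 (f : R -> R) :
  {within (@I11 R : set R), continuous (f : R -> R^o)} ->
  mu.-integrable (@I11 R) (EFin \o f).
Proof. by apply: continuous_compact_integrable; exact: compact_I11. Qed.

Lemma Rintegral_I11_cst (c : R) : \int[mu]_(t in @I11 R) c = 2 * c.
Proof.
rewrite Rintegral_cst; last exact: measurable_I11.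
rewrite mulrC; congr (_ * _).
have -> : fine (lebesgue_measure (@I11 R)) = 2; last by [].
rewrite /I11 lebesgue_measure_itv/= lte_fin ifT; first by rewrite /=; lra.
by lra.
Qed.

Lemma bounded_CI h : CI h -> exists2 M : R, 0 <= M &
  forall s, I11 s -> normc (h s) <= M.
Proof.
move=> /continuous_normc ch.
have /compact_bounded[M [_ Mh]] := continuous_compact ch compact_I11.
exists (`|M| + 1); first by rewrite addr_ge0.
move=> s Is; apply: le_trans (ler_norm _) _; apply: Mh; last by exists s.
by rewrite (le_lt_trans (ler_norm _))// ltrDl.
Qed.

End ContinuousFunctions.

(** * Complex integrals and the 2-norm *)

Section Integrals.
Variable R : realType.
Implicit Types (f g h : R -> R[i]).
Local Notation mu := (@lebesgue_measure R).
Local Notation I := (@I11 R).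

Definition real_CI (F : R -> R) := {within I, continuous (F : R -> R^o)}.

Lemma real_CI_cst (c : R) : real_CI (fun=> c).
Proof. by move=> x; exact: cvg_cst. Qed.

Lemma real_CI_D (F G : R -> R) : real_CI F -> real_CI G ->
  real_CI (fun t => F t + G t).
Proof. by move=> cF cG x; apply: (@cvgD _ R^o); [exact: cF|exact: cG]. Qed.

Lemma real_CI_M (F G : R -> R) : real_CI F -> real_CI G ->
  real_CI (fun t => F t * G t).
Proof. by move=> cF cG x; apply: (@cvgM R); [exact: cF|exact: cG]. Qed.

Lemma real_CI_normc h : CI h -> real_CI (fun t => normc (h t)).
Proof. exact: continuous_normc. Qed.

Lemma real_CI_sqr_normc h : CI h -> real_CI (fun t => normc (h t) ^+ 2).
Proof. by move=> /real_CI_normc ch; exact: real_CI_M. Qed.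

Lemma real_CI_Re h : CI h -> real_CI (fun t => complex.Re (h t)).
Proof. exact: continuous_Re. Qed.

Lemma real_CI_Im h : CI h -> real_CI (fun t => complex.Im (h t)).
Proof. exact: continuous_Im. Qed.

Lemma real_CI_norm (F : R -> R) : real_CI F -> real_CI (fun t => `|F t|).
Proof. by move=> cF x; apply: (@cvg_norm _ R^o); exact: cF. Qed.

Lemma Rintegral_I11D (F G : R -> R) : real_CI F -> real_CI G ->
  \int[mu]_(t in I) (F t + G t) =
  \int[mu]_(t in I) F t + \int[mu]_(t in I) G t.
Proof.
move=> cF cG; rewrite RintegralD//; first exact: measurable_I11.
all: exact: integrable_I11.
Qed.

Lemma Rintegral_I11Z (c : R) (F : R -> R) : real_CI F ->
  \int[mu]_(t in I) (c * F t) = c * \int[mu]_(t in I) F t.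
Proof.
move=> cF; rewrite RintegralZl//; first exact: measurable_I11.
exact: integrable_I11.
Qed.

Lemma le_Rintegral_I11 (F G : R -> R) : real_CI F -> real_CI G ->
  (forall t, I t -> F t <= G t) ->
  \int[mu]_(t in I) F t <= \int[mu]_(t in I) G t.
Proof.
move=> cF cG FG; apply: le_Rintegral => //; first exact: measurable_I11.
all: exact: integrable_I11.
Qed.

Lemma eq_cintegral f g : (forall t, I t -> f t = g t) ->
  cintegral f = cintegral g.
Proof.
by move=> fg; congr (_ +i* _); apply: eq_Rintegral => t /set_mem/fg ->.
Qed.

Lemma cintegral_lin (a : R[i]) f g : CI f -> CI g ->
  cintegral (fun t => a * f t + g t) = a * cintegral f + cintegral g.
Proof.
move=> cf cg.
have rf := real_CI_Re cf; have jf := real_CI_Im cf.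
have rg := real_CI_Re cg; have jg := real_CI_Im cg.
have cZ c (F : R -> R) : real_CI F -> real_CI (fun t => c * F t).
  exact/real_CI_M/real_CI_cst.
case: a => p q; rewrite /cintegral; apply/eqP; rewrite eq_complex /=.
apply/andP; split; apply/eqP.
- rewrite -mulNr -(Rintegral_I11Z p rf) -(Rintegral_I11Z (- q) jf).
  rewrite -(Rintegral_I11D (cZ _ _ rf) (cZ _ _ jf)).
  rewrite -(Rintegral_I11D (real_CI_D (cZ _ _ rf) (cZ _ _ jf)) rg).
  by apply: eq_Rintegral => t _; case: (f t) (g t) => a b [] c d /=; ring.
- rewrite -(Rintegral_I11Z p jf) -(Rintegral_I11Z q rf).
  rewrite -(Rintegral_I11D (cZ _ _ jf) (cZ _ _ rf)).
  rewrite -(Rintegral_I11D (real_CI_D (cZ _ _ jf) (cZ _ _ rf)) jg).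
  by apply: eq_Rintegral => t _; case: (f t) (g t) => a b [] c d /=; ring.
Qed.

(** Bounding the real and imaginary parts separately costs the factor 2. *)
Lemma normc_cintegral_le h : CI h ->
  normc (cintegral h) <= 2 * \int[mu]_(t in I) normc (h t).
Proof.
move=> ch; have mI := @measurable_I11 R.
apply: le_trans (ler_normc_ReIm _) _; rewrite /= mulrDl mul1r.
have cN := real_CI_normc ch; have rh := real_CI_Re ch; have jh := real_CI_Im ch.
apply: lerD; (apply: le_trans; first exact/le_normr_Rintegral/integrable_I11).
- apply: le_Rintegral_I11 => // [|t _]; first exact: real_CI_norm.
  exact: ler_Re_normc.
- apply: le_Rintegral_I11 => // [|t _]; first exact: real_CI_norm.
  exact: ler_Im_normc.
Qed.

Lemma sqr_norm2E h : norm2 h ^+ 2 = \int[mu]_(t in I) (normc (h t) ^+ 2).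
Proof.
by rewrite sqr_sqrtr//; apply: Rintegral_ge0 => t _; exact: sqr_ge0.
Qed.

Lemma norm2_ge0 h : 0 <= norm2 h. Proof. exact: sqrtr_ge0. Qed.

Lemma eq_norm2 f g : (forall s, I s -> f s = g s) -> norm2 f = norm2 g.
Proof.
by move=> fg; congr Num.sqrt; apply: eq_Rintegral => t /set_mem/fg ->.
Qed.

Lemma norm2_cst (c : R[i]) : norm2 (fun=> c) ^+ 2 = 2 * normc c ^+ 2.
Proof. by rewrite sqr_norm2E Rintegral_I11_cst. Qed.

Lemma norm2_le_sup h (B : R) : CI h -> 0 <= B ->
  (forall s, I s -> normc (h s) <= B) -> norm2 h <= 2 * B.
Proof.
move=> ch B0 hB; rewrite -(@ler_pXn2r _ 2) ?nnegrE ?norm2_ge0 ?mulr_ge0//.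
have : norm2 h ^+ 2 <= 2 * B ^+ 2.
  rewrite sqr_norm2E -Rintegral_I11_cst; apply: le_Rintegral_I11.
  - exact: real_CI_sqr_normc.
  - exact: real_CI_cst.
  - by move=> s /hB; have := normc_ge0 (h s); nra.
by nra.
Qed.

(** The factor 2 replaces Minkowski's inequality by the pointwise bound
    |f + g|^2 <= 2 |f|^2 + 2 |g|^2. *)
Lemma norm2D f g : CI f -> CI g ->
  norm2 (fun s => f s + g s) <= 2 * (norm2 f + norm2 g).
Proof.
move=> cf cg.
rewrite -(@ler_pXn2r _ 2) ?nnegrE ?norm2_ge0 ?mulr_ge0 ?addr_ge0 ?norm2_ge0//.
suff : norm2 (fun s => f s + g s) ^+ 2 <= 2 * norm2 f ^+ 2 + 2 * norm2 g ^+ 2.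
  by have := norm2_ge0 f; have := norm2_ge0 g; nra.
have f2 := real_CI_sqr_normc cf; have g2 := real_CI_sqr_normc cg.
have c2 F : real_CI F -> real_CI (fun t => 2 * F t).
  exact/real_CI_M/real_CI_cst.
rewrite !sqr_norm2E -(Rintegral_I11Z 2 f2) -(Rintegral_I11Z 2 g2).
rewrite -(Rintegral_I11D (c2 _ f2) (c2 _ g2)); apply: le_Rintegral_I11.
- by apply: real_CI_sqr_normc; exact: CI_D.
- exact: real_CI_D (c2 _ f2) (c2 _ g2).
- move=> t _; have : normc (f t + g t) ^+ 2 <= (normc (f t) + normc (g t)) ^+ 2.
    by rewrite ler_pXn2r ?nnegrE ?addr_ge0 ?normc_ge0// normcD.
  by have := sqr_ge0 (normc (f t) - normc (g t)); nra.
Qed.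

(** Cauchy-Schwarz against the constant 1: on an interval of length 2 the mean
    of |h| is J / 2, and the integral of (|h| - J / 2)^2 is nonnegative. *)
Lemma integral_normc_le h : CI h ->
  \int[mu]_(t in I) normc (h t) <= 2 * norm2 h.
Proof.
move=> ch; set J := \int[mu]_(t in I) _.
have cN := real_CI_normc ch; have cN2 := real_CI_sqr_normc ch.
rewrite -(@ler_pXn2r _ 2) ?nnegrE ?mulr_ge0 ?norm2_ge0//; last first.
  by apply: Rintegral_ge0 => t _; exact: normc_ge0.
suff : 0 <= norm2 h ^+ 2 - J ^+ 2 + J ^+ 2 / 2.
  by have := sqr_ge0 (norm2 h); nra.
have : 0 <= \int[mu]_(t in I) (normc (h t) - J / 2) ^+ 2.
  by apply: Rintegral_ge0 => t _; exact: sqr_ge0.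
have cJ : real_CI (fun t => - J * normc (h t)).
  exact/real_CI_M/cN/real_CI_cst.
have -> : \int[mu]_(t in I) (normc (h t) - J / 2) ^+ 2 = \int[mu]_(t in I)
    (normc (h t) ^+ 2 + - J * normc (h t) + (J / 2) ^+ 2).
  by apply: eq_Rintegral => t _; field.
have c2 : real_CI (fun=> (J / 2) ^+ 2) by exact: real_CI_cst.
rewrite (Rintegral_I11D (real_CI_D cN2 cJ) c2) (Rintegral_I11D cN2 cJ).
rewrite (Rintegral_I11Z _ cN) Rintegral_I11_cst -sqr_norm2E.
by rewrite -/J; lra.
Qed.

End Integrals.

(** * Small perturbations of the identity *)

Section Neumann.
Variable R : realType.
Implicit Types (f g h : R -> R[i]).
Local Notation I := (@I11 R).

Lemma geometric_small (M e : R) : 0 < e -> exists n : nat, M / 2 ^+ n < e.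
Proof.
move=> e0; have [k Mk] : exists k : nat, M / e < k%:R.
  by exists (Num.truncn (M / e)).+1; exact: truncnS_gt.
exists k; rewrite ltr_pdivrMr ?exprn_gt0// mulrC -ltr_pdivrMr//.
by apply: lt_le_trans Mk _; rewrite -natrX ler_nat ltnW// ltn_expl.
Qed.

(** The sequences u_n - 2M/2^n and u_n + 2M/2^n are monotone and enclose each
    other, so the supremum of the lower one lies in all the enclosures. *)
Lemma geometric_limit (u : nat -> R) (M : R) :
  (forall n, `|u n.+1 - u n| <= M / 2 ^+ n) ->
  exists l, forall n, `|l - u n| <= 2 * M / 2 ^+ n.
Proof.
move=> uM; pose w n := u n - 2 * M / 2 ^+ n; pose v n := u n + 2 * M / 2 ^+ n.
have half n : 2 * M / 2 ^+ n.+1 = M / 2 ^+ n.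
  by rewrite exprS; field; rewrite expf_neq0.
have wS n : w n <= w n.+1.
  have := uM n; rewrite /w half ler_norml => /andP[+ _].
  have -> : 2 * M / 2 ^+ n = M / 2 ^+ n + M / 2 ^+ n.
    by field; rewrite expf_neq0.
  by move: (M / 2 ^+ n) => q; lra.
have vS n : v n.+1 <= v n.
  have := uM n; rewrite /v half ler_norml => /andP[_].
  have -> : 2 * M / 2 ^+ n = M / 2 ^+ n + M / 2 ^+ n.
    by field; rewrite expf_neq0.
  by move: (M / 2 ^+ n) => q; lra.
have wv n m : w n <= v m.
  have ww : {homo w : i j / (i <= j)%N >-> i <= j}.
    by apply: homo_leq => //; exact: le_trans.
  have vv : {homo v : i j / (i <= j)%N >-> j <= i}.
    by apply: homo_leq => // a b c ba ac; exact: le_trans ac ba.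
  apply: (le_trans (ww _ _ (leq_maxl n m))).
  apply: le_trans (vv _ _ (leq_maxr n m)).
  have := uM (maxn n m); have := normr_ge0 (u (maxn n m).+1 - u (maxn n m)).
  rewrite /w /v; have -> : 2 * M / 2 ^+ maxn n m =
    M / 2 ^+ maxn n m + M / 2 ^+ maxn n m by field; rewrite expf_neq0.
  by move: (M / 2 ^+ _) => q; lra.
exists (sup (range w)) => n; rewrite ler_distl; apply/andP; split.
  apply: ub_le_sup; last by exists n.
  by exists (v 0%N) => _ [m _ <-]; exact: wv.
apply: ge_sup; first by exists (w 0%N), 0%N.
by move=> _ [m _ <-]; exact: wv.
Qed.

Lemma geometric_limitC (u : nat -> R[i]) (M : R) :
  (forall n, normc (u n.+1 - u n) <= M / 2 ^+ n) ->
  exists l, forall n, normc (l - u n) <= 4 * M / 2 ^+ n.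
Proof.
move=> uM.
have [n|a aP] := @geometric_limit (fun n => complex.Re (u n)) M.
  apply: le_trans (uM n); apply: le_trans (ler_Re_normc _).
  by case: (u n.+1) (u n) => ? ? [].
have [n|b bP] := @geometric_limit (fun n => complex.Im (u n)) M.
  apply: le_trans (uM n); apply: le_trans (ler_Im_normc _).
  by case: (u n.+1) (u n) => ? ? [].
exists (a +i* b) => n; apply: le_trans (ler_normc_ReIm _) _.
have -> : 4 * M / 2 ^+ n = 2 * M / 2 ^+ n + 2 * M / 2 ^+ n.
  by field; rewrite expf_neq0.
by have := aP n; have := bP n; case: (u n) => c d /= ? ?; apply: lerD.
Qed.

Lemma CI_uniform_limit h :
  (forall e : R, 0 < e -> exists2 u, CI u &
     forall s, I s -> normc (h s - u s) <= e) -> CI h.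
Proof.
move=> hu; apply/CI_epsP => s Is e e0.
have [|u /CI_epsP cu uh] := hu (e / 4); first by rewrite divr_gt0.
have [|d d0 dP] := cu s Is (e / 4); first by rewrite divr_gt0.
exists d => // t It ts; have := dP t It ts; have := uh s Is; have := uh t It.
have := normcD (h t - u t) (u t - u s + (u s - h s)).
have := normcD (u t - u s) (u s - h s).
have -> : h t - u t + (u t - u s + (u s - h s)) = h t - h s by ring.
by rewrite (normcB_sym (u s) (h s)); lra.
Qed.

(** Elements of C(I) are represented by functions on the whole line, so T has to
    be compatible with equality on the interval before linearity makes sense. *)
Definition linear_on_CI (T : (R -> R[i]) -> R -> R[i]) : Prop :=
  (forall f g, (forall t, I t -> f t = g t) -> T f = T g) /\
  (forall (a : R[i]) f g, CI f -> CI g -> forall s, I s ->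
     T (fun t => a * f t + g t) s = a * T f s + T g s).

Section LinearOn.
Variable T : (R -> R[i]) -> R -> R[i].
Hypothesis Tl : linear_on_CI T.

Lemma linear_on0 s : I s -> T (fun=> 0) s = 0.
Proof.
move=> Is.
have := Tl.2 (-1) _ _ (@CI_cst R 0) (@CI_cst R 0) s Is.
have -> : (fun _ : R => -1 * 0 + 0 : R[i]) = fun=> 0.
  by apply/funext => t; rewrite mulr0 addr0.
by rewrite mulN1r addNr.
Qed.

Lemma linear_onB f g s : CI f -> CI g -> I s ->
  T (fun t => f t - g t) s = T f s - T g s.
Proof.
move=> cf cg Is; have := Tl.2 (-1) _ _ cg cf s Is.
have -> : (fun t => -1 * g t + f t) = fun t => f t - g t.
  by apply/funext => t; rewrite mulN1r addrC.
by rewrite mulN1r addrC.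
Qed.

Lemma linear_on_sum (J : Type) (r : seq J) (c : J -> R[i])
    (F : J -> R -> R[i]) s :
  (forall j, CI (F j)) -> I s ->
  T (fun t => \sum_(j <- r) c j * F j t) s = \sum_(j <- r) c j * T (F j) s.
Proof.
move=> cF Is; elim: r => [|j r IH].
  rewrite big_nil -[RHS](linear_on0 Is); congr (T _ s).
  by apply/funext => t; rewrite big_nil.
rewrite big_cons -IH -Tl.2; first 1 last.
- exact: cF.
- by apply: CI_sum => i; apply: CI_M; [exact: CI_cst|exact: cF].
- exact: Is.
by congr (T _ s); apply/funext => t; rewrite big_cons.
Qed.

End LinearOn.

(** The iterates of v |-> g + E v form the Neumann series of g.  As the 2-norm
    is at most twice the sup norm, E contracts the sup norm by the factor 1/4,
    so the iterates converge uniformly; the bound by 1/8 of the 2-norm also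
    controls the solution in that norm. *)
Lemma neumann_inverse (E : (R -> R[i]) -> R -> R[i]) :
  linear_on_CI E -> (forall h, CI h -> CI (E h)) ->
  (forall h, CI h -> forall s, I s -> normc (E h s) <= norm2 h / 8) ->
  forall g, CI g -> exists h, [/\ CI h, norm2 h <= 4 * norm2 g &
    forall s, I s -> h s - E h s = g s].
Proof.
move=> El cE Eb g cg.
have [u [u0 uS]] : exists u : nat -> R -> R[i],
    u 0%N = g /\ forall n, u n.+1 = (fun s => g s + E (u n) s).
  by exists (fun n => iter n (fun v s => g s + E v s) g).
have cu n : CI (u n).
  elim: n => [|n IH]; first by rewrite u0.
  by rewrite uS; apply: CI_D; [exact: cg|exact: cE].
have M0 : 0 <= norm2 g := norm2_ge0 g.
have du n s : I s -> normc (u n.+1 s - u n s) <= norm2 g / 2 ^+ n.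
  elim: n s => [|n IH] s Is.
    rewrite uS u0 addrAC subrr add0r expr0.
    by apply: le_trans (Eb _ cg _ Is) _; lra.
  have -> : u n.+2 s - u n.+1 s = E (fun t => u n.+1 t - u n t) s.
    rewrite (linear_onB El (cu n.+1) (cu n) Is) uS [in u n.+1 s]uS.
    by rewrite opprD addrACA subrr add0r.
  apply: le_trans (Eb _ (CI_B (cu n.+1) (cu n)) _ Is) _.
  have q0 : 0 <= norm2 g / 2 ^+ n by rewrite divr_ge0// exprn_ge0.
  have := norm2_le_sup (CI_B (cu n.+1) (cu n)) q0 IH.
  have -> : norm2 g / 2 ^+ n.+1 = norm2 g / 2 ^+ n / 2.
    by rewrite exprS; field; rewrite expf_neq0.
  by move: (norm2 g / 2 ^+ n) q0 => q q0; lra.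
have /choice[h hP] : forall s, exists l : R[i], I s ->
    forall n, normc (l - u n s) <= 4 * norm2 g / 2 ^+ n.
  move=> s.
  have [Is|nIs] := pselect (I s); last by exists 0.
  by have [l lP] := geometric_limitC (fun n => du n s Is); exists l.
have ch : CI h.
  apply: CI_uniform_limit => e e0.
  have [n /ltW ne] := geometric_small (4 * norm2 g) e0.
  exists (u n); first exact: cu.
  by move=> s Is; exact: le_trans (hP s Is n) ne.
have hE s : I s -> h s - E h s = g s.
  move=> Is; apply/eqP; rewrite -subr_eq0; apply/eqP/eq0_normc/eqP.
  rewrite eq_le normc_ge0 andbT leNgt; apply/negP => e0.
  have [n] := geometric_small (8 * norm2 g) e0; apply/negP; rewrite -leNgt.
  have -> : h s - E h s - g s =
      h s - u n.+1 s - E (fun t => h t - u n t) s.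
    by rewrite (linear_onB El ch (cu n) Is) uS; ring.
  have q0 : 0 <= norm2 g / 2 ^+ n by rewrite divr_ge0// exprn_ge0.
  have q4 : 0 <= 4 * norm2 g / 2 ^+ n by rewrite divr_ge0 ?exprn_ge0 ?mulr_ge0.
  have := norm2_le_sup (CI_B ch (cu n)) q4 (fun s Is => hP s Is n).
  have := Eb _ (CI_B ch (cu n)) s Is; have := hP s Is n.+1.
  have := normcD (h s - u n.+1 s) (- E (fun t => h t - u n t) s).
  rewrite normc_opp.
  have -> : 4 * norm2 g / 2 ^+ n.+1 = 2 * (norm2 g / 2 ^+ n).
    by rewrite exprS; field; rewrite expf_neq0.
  by rewrite -!mulrA; move: (norm2 g / 2 ^+ n) q0 => q q0; lra.
exists h; split; [exact: ch| |exact: hE].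
have eh0 : 0 <= norm2 h / 8 by rewrite divr_ge0// norm2_ge0.
have := norm2_le_sup (cE _ ch) eh0 (Eb _ ch).
have := norm2D cg (cE _ ch).
rewrite (@eq_norm2 _ _ h) => [|s Is]; last by rewrite -hE// subrK.
by lra.
Qed.

End Neumann.

(** * The Fredholm alternative *)

Section Fredholm.
Variable R : realType.
Implicit Types (f g h : R -> R[i]).
Local Notation I := (@I11 R).

Lemma CI_of_real (w : R -> R) :
  (forall s, I s -> {for s, continuous (w : R -> R^o)}) ->
  CI (fun s => (w s)%:C).
Proof.
move=> cw; apply/CI_epsP => s Is e e0.
have /cvgrPdist_lt /(_ _ e0) /nbhs_ballP[d /= d0 dP] := cw s Is.
exists d; first exact: d0.
move=> t _ ts.
have : normc (w t - w s)%:C < e.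
  by rewrite normc_real distrC; apply: dP; rewrite /ball/= distrC.
by rewrite rmorphB.
Qed.

Lemma continuous_sum (J : Type) (r : seq J) (F : J -> R -> R) :
  (forall j, continuous (F j : R -> R^o)) ->
  continuous ((fun x => \sum_(j <- r) F j x) : R -> R^o).
Proof.
move=> cF; elim: r => [|j r IH] x.
  have -> : (fun x => \sum_(j <- [::]) F j x) = fun=> 0.
    by apply/funext => t; rewrite big_nil.
  exact: cvg_cst.
have -> : (fun x => \sum_(j <- j :: r) F j x) =
    fun x => F j x + \sum_(j <- r) F j x.
  by apply/funext => t; rewrite big_cons.
by apply: (@cvgD _ R^o); [exact: cF|exact: IH].
Qed.

(** Normalized tent functions of half-width d centred at the grid points
    i d - 1, for i up to 2 / d.  The point s lies within d of the grid point
    with index the integer part of (s + 1) / d, so the tents do not all vanish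
    at s. *)
Lemma partition_of_unity (d : R) : 0 < d ->
  exists (N : nat) (p : 'I_N -> R) (w : 'I_N -> R -> R),
    [/\ forall i, I (p i), forall i, CI (fun s => (w i s)%:C),
        forall s, I s -> \sum_i w i s = 1
      & forall i s, I s -> 0 <= w i s /\ (`|s - p i| < d \/ w i s = 0)].
Proof.
move=> d0; pose N := (Num.truncn (2 / d)).+1.
pose p (i : 'I_N) : R := i%:R * d - 1.
pose b (i : 'I_N) (s : R) := Num.max 0 (d - `|s - p i|).
have b_ge0 i s : 0 <= b i s by rewrite le_max lexx.
have D0 s : I s -> 0 < \sum_i b i s.
  rewrite /I11/= in_itv/= => /andP[s1 s2].
  have sd : 0 <= (s + 1) / d by rewrite divr_ge0; lra.
  have jN : (Num.truncn ((s + 1) / d) < N)%N.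
    by rewrite ltnS; apply: le_truncn; rewrite ler_pM2r ?invr_gt0//; lra.
  rewrite (bigD1 (Ordinal jN))//= ltr_pwDl ?sumr_ge0//.
  rewrite lt_max subr_gt0; apply/orP; right; rewrite /p/=.
  have := truncn_itv sd; rewrite ler_pdivlMr// ltr_pdivrMr// -natr1 => /andP[].
  by move: (_%:R) => k k1 k2; rewrite ger0_norm; lra.
have cb i : continuous (b i : R -> R^o).
  move=> x; rewrite (_ : b i = (fun=> 0) \max (fun t => d - `|t - p i|))//.
  apply: continuous_max; first exact: cvg_cst.
  apply: (@cvgB _ R^o); first exact: cvg_cst.
  apply: (@cvg_norm _ R^o); apply: (@cvgB _ R^o); first exact: cvg_id.
  exact: cvg_cst.
exists N, p, (fun i s => b i s / \sum_j b j s); split.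
- move=> i; rewrite /I11/= in_itv/= /p.
  have id0 : 0 <= i%:R * d by rewrite mulr_ge0// ltW.
  have : i%:R * d <= 2; last by lra.
  rewrite -ler_pdivlMr// (@le_trans _ _ (Num.truncn (2 / d))%:R)//.
    by rewrite ler_nat -ltnS.
  by have /truncn_itv/andP[] : 0 <= 2 / d by rewrite divr_ge0// ltW.
- move=> i; apply: CI_of_real => s Is; apply: (@cvgM R); first exact: cb.
  apply: (@cvgV R); first by rewrite gt_eqF// D0.
  by apply: continuous_sum => j; exact: cb.
- by move=> s Is; rewrite -mulr_suml divff// gt_eqF// D0.
- move=> i s Is; split; first by rewrite divr_ge0// ltW// D0.
  have [sp|sp] := ltP `|s - p i| d; [by left|right].
  by rewrite /b (max_idPl _) ?mul0r// subr_le0.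
Qed.

(** The two quantitative clauses say that T maps bounded sets of the 2-norm to
    bounded equicontinuous families; by the Arzela-Ascoli theorem this is
    compactness from the 2-norm to the sup norm. *)
Definition smoothing (T : (R -> R[i]) -> R -> R[i]) : Prop :=
  [/\ linear_on_CI T,
      exists2 B : R, 0 <= B &
        forall h, CI h -> forall s, I s -> normc (T h s) <= B * norm2 h
    & forall e : R, 0 < e -> exists2 d : R, 0 < d &
        forall h, CI h -> forall s t, I s -> I t -> `|s - t| < d ->
          normc (T h s - T h t) <= e * norm2 h].

Lemma CI_smoothing T h : smoothing T -> CI h -> CI (T h).
Proof.
move=> [_ _ eqT] ch; apply/CI_epsP => s Is e e0.
have n0 : 0 < norm2 h + 1 by have := norm2_ge0 h; lra.
have [|d d0 dP] := eqT (e / (norm2 h + 1)); first by rewrite divr_gt0.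
exists d => // t It ts; apply: le_lt_trans (dP h ch t s It Is ts) _.
by rewrite mulrAC ltr_pdivrMr// ltr_pM2l// ltrDl.
Qed.

(** T h is replaced by its interpolation at the grid points.  Since the phi_i
    sum to 1, the error at s is an average of the differences T h s - T h (p i)
    over grid points close to s, which equicontinuity bounds. *)
Lemma finite_rank_approximation T : smoothing T ->
  exists (N : nat) (p : 'I_N -> R) (phi : 'I_N -> R -> R[i]),
    [/\ forall i, I (p i), forall i, CI (phi i)
      & forall h, CI h -> forall s, I s ->
          normc (T h s - \sum_i phi i s * T h (p i)) <= norm2 h / 8].
Proof.
move=> [_ _ eqT]; have [|d d0 dP] := eqT (8^-1); first by rewrite invr_gt0.
have [N [p [w [Ip cw w1 wP]]]] := partition_of_unity d0.
exists N, p, (fun i s => (w i s)%:C); split => [//|i|h ch s Is].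
  exact: cw.
have -> : T h s - \sum_i (w i s)%:C * T h (p i) =
    \sum_i (w i s)%:C * (T h s - T h (p i)).
  rewrite -{1}[T h s]mul1r -[1]/((1 : R)%:C) -(w1 s Is) rmorph_sum mulr_suml.
  by rewrite -sumrB; apply: eq_bigr => i _; rewrite mulrBr.
apply: le_trans (normc_sum _ _) _.
have -> : norm2 h / 8 = \sum_i w i s * (norm2 h / 8).
  by rewrite -mulr_suml w1// mul1r.
apply: ler_sum => i _.
have [w0 sp] := wP i s Is; rewrite normcM normc_real ger0_norm//.
case: sp => [sp|->]; last by rewrite !mul0r.
by apply: ler_wpM2l => //; rewrite [leRHS]mulrC; exact: dP.
Qed.

Lemma linear_onD T f g s : linear_on_CI T -> CI f -> CI g -> I s ->
  T (fun t => f t + g t) s = T f s + T g s.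
Proof.
move=> Tl cf cg Is; have := Tl.2 1 _ _ cf cg s Is; rewrite mul1r => <-.
by congr (T _ s); apply/funext => t; rewrite mul1r.
Qed.

(** With E = T - D and psi_i the solution of psi_i - E psi_i = phi_i, a solution
    of h - T h = g is sought as h = u + sum_j c_j psi_j where u - E u = g.
    Applying id - T gives g + sum_i (c_i - (T h)(p_i)) phi_i, so one needs
    c_i = (T h)(p_i), which is the linear system (1 - A) c = b with
    A_ij = (T psi_j)(p_i) and b_i = (T u)(p_i). *)
Theorem fredholm_alternative T : smoothing T ->
  (forall h, CI h -> (forall s, I s -> T h s = h s) ->
    forall s, I s -> h s = 0) ->
  exists2 C : R, 0 <= C & forall g, CI g ->
    exists h, [/\ CI h, norm2 h <= C * norm2 g &
      forall s, I s -> h s - T h s = g s].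
Proof.
move=> sT injT; have [Tl [B B0 TB] _] := sT.
have cT h : CI h -> CI (T h) by exact: CI_smoothing.
have [N [p [phi [Ip cphi phiP]]]] := finite_rank_approximation sT.
pose E h s := T h s - \sum_i phi i s * T h (p i).
have El : linear_on_CI E.
  split=> [f g fg|a f g cf cg s Is]; first by rewrite /E (Tl.1 _ _ fg).
  rewrite /E (Tl.2 _ _ _ cf cg _ Is).
  have -> : \sum_i phi i s * T (fun t => a * f t + g t) (p i) =
      a * (\sum_i phi i s * T f (p i)) + \sum_i phi i s * T g (p i).
    rewrite mulr_sumr -big_split; apply: eq_bigr => i _ /=.
    by rewrite (Tl.2 _ _ _ cf cg _ (Ip i)); ring.
  by ring.
have cE h : CI h -> CI (E h).
  move=> ch; apply: CI_B; first exact: cT.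
  by apply: CI_sum => i; apply: CI_M; [exact: cphi|exact: CI_cst].
have inv := neumann_inverse El cE phiP.
have /choice[psi psiP] : forall i, exists h, CI h /\
    forall s, I s -> h s - E h s = phi i s.
  by move=> i; have [h [ch _ hE]] := inv _ (cphi i); exists h; split.
have cpsi i : CI (psi i) := (psiP i).1.
pose comb (c : 'I_N -> R[i]) t := \sum_j c j * psi j t.
have ccomb c : CI (comb c).
  by apply: CI_sum => j; apply: CI_M; [exact: CI_cst|exact: cpsi].
have combE c s : I s -> comb c s - E (comb c) s = \sum_j c j * phi j s.
  move=> Is; rewrite (linear_on_sum El _ _ cpsi Is) /comb.
  by rewrite -sumrB; apply: eq_bigr => j _; rewrite -mulrBr (psiP j).2.
have TE h s : h s - T h s = h s - E h s - \sum_i phi i s * T h (p i).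
  by rewrite /E; ring.
pose A : 'M[R[i]]_N := \matrix_(i, j) T (psi j) (p i).
have TcombE c i : T (comb c) (p i) = \sum_j c j * A i j.
  rewrite (linear_on_sum Tl _ _ cpsi (Ip i)).
  by apply: eq_bigr => j _; rewrite mxE.
have uM : 1%:M - A \in unitmx.
  (* A kernel vector v would give the fixed point sum_j v_j psi_j of T; it
     vanishes on the interval, and its images under T at the p_i are the v_i. *)
  rewrite -unitmx_tr unitmxE unitfE; apply/negP => /det0P[v v0 vM].
  have vE i : T (comb (v 0)) (p i) = v 0 i.
    rewrite TcombE; have := congr1 (fun u : 'rV_N => u 0 i) vM.
    rewrite linearB/= trmx1 mulmxBr mulmx1 !mxE => /eqP; rewrite subr_eq0.
    by move=> /eqP ->; apply: eq_bigr => j _; rewrite !mxE.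
  have h0 := injT _ (ccomb (v 0)).
  have {}h0 s : I s -> comb (v 0) s = 0.
    move=> Is; apply: h0 => // t It; apply/esym/eqP.
    rewrite -subr_eq0 TE combE//.
    rewrite subr_eq0; apply/eqP/eq_bigr => i _.
    by rewrite vE mulrC.
  move/eqP: v0; apply; apply/rowP => i; rewrite -vE mxE.
  by rewrite (Tl.1 _ _ h0) (linear_on0 Tl (Ip i)).
have /choice[P PP] : forall i, exists M : R, 0 <= M /\
    forall s, I s -> normc (psi i s) <= M.
  by move=> i; have [M M0 MP] := bounded_CI (cpsi i); exists M.
pose beta j := \sum_k normc (invmx (1%:M - A) j k) * (4 * B).
have beta0 j : 0 <= beta j.
  by apply: sumr_ge0 => k _; rewrite mulr_ge0 ?normc_ge0 ?mulr_ge0.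
exists (2 * (4 + 2 * \sum_j beta j * P j)).
  rewrite mulr_ge0// addr_ge0// mulr_ge0// sumr_ge0// => j _.
  by rewrite mulr_ge0//; exact: (PP j).1.
move=> g cg; have [u [cu un uE]] := inv _ cg.
pose b : 'cV[R[i]]_N := \col_i T u (p i).
pose c : 'cV[R[i]]_N := invmx (1%:M - A) *m b.
have cb i : T u (p i) + \sum_j c j 0 * A i j = c i 0.
  have bc : b + A *m c = c.
    by rewrite -{1}(mulKVmx uM b) -/c mulmxBl mul1mx subrK.
  have := congr1 (fun x : 'cV_N => x i 0) bc; rewrite [LHS]mxE => <-.
  by congr (_ + _); rewrite mxE//; apply: eq_bigr => j _; rewrite mulrC.
pose h s := u s + comb (fun j => c j 0) s.
have ch : CI h by apply: CI_D; [exact: cu|exact: ccomb].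
have cn j : normc (c j 0) <= beta j * norm2 g.
  rewrite mxE mulr_suml; apply: le_trans (normc_sum _ _) _.
  apply: ler_sum => k _; rewrite normcM -!mulrA ler_wpM2l ?normc_ge0// mxE.
  apply: le_trans (TB _ cu _ (Ip k)) _; rewrite mulrCA ler_wpM2l//.
exists h; split; [exact: ch| |].
- apply: le_trans (norm2D cu (ccomb _)) _.
  rewrite -mulrA ler_wpM2l// mulrDl lerD// -mulrA mulr_suml.
  apply: norm2_le_sup; first exact: ccomb.
    apply: sumr_ge0 => j _; rewrite !mulr_ge0 ?norm2_ge0//; exact: (PP j).1.
  move=> s Is; apply: le_trans (normc_sum _ _) _; apply: ler_sum => j _.
  rewrite normcM mulrAC ler_pM ?normc_ge0//; exact: (PP j).2.
- move=> s Is; rewrite TE /h (linear_onD El cu (ccomb _) Is).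
  rewrite opprD addrACA uE// combE// -addrA -sumrB big1 ?addr0// => i _.
  by rewrite (linear_onD Tl cu (ccomb _) (Ip i)) TcombE cb mulrC subrr.
Qed.

End Fredholm.

(** * Integral operators with a continuous kernel *)

Section KernelOperators.
Variable R : realType.
Implicit Types (f g h : R -> R[i]) (k : R -> R -> R[i]).
Local Notation I := (@I11 R).
Local Notation mu := (@lebesgue_measure R).

Lemma CI2_epsP k s t (e : R) : CI2 k -> I s -> I t -> 0 < e ->
  exists2 d : R, 0 < d & forall s' t', I s' -> I t' ->
    `|s - s'| < d -> `|t - t'| < d -> normc (k s t - k s' t') < e.
Proof.
move=> /subspace_continuousP ck Is It e0.
have /cvg_normcP /(_ _ e0) := ck (s, t) (conj Is It).
rewrite near_withinE => /nbhs_ballP[d /= d0 dP]; exists d; first exact: d0.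
by move=> s' t' Is' It' ss' tt'; exact: (dP (s', t')).
Qed.

Lemma CI_section k s : CI2 k -> I s -> CI (k s).
Proof.
move=> ck Is; apply/CI_epsP => t It e e0.
have [d d0 dP] := CI2_epsP ck Is It e0; exists d; first exact: d0.
move=> t' It' tt'; rewrite normcB_sym; apply: dP => //.
  by rewrite subrr normr0.
by rewrite distrC.
Qed.

Lemma compact_I11X : compact (I `*` I).
Proof. by apply: compact_setX; exact: compact_I11. Qed.

Lemma bounded_CI2 k : CI2 k -> exists2 M : R, 0 <= M &
  forall s t, I s -> I t -> normc (k s t) <= M.
Proof.
move=> /continuous_normc ck.
have /compact_bounded[M [_ Mk]] := continuous_compact ck compact_I11X.
exists (`|M| + 1); first by rewrite addr_ge0.
move=> s t Is It; apply: le_trans (ler_norm _) _.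
apply: Mk; last by exists (s, t).
by rewrite (le_lt_trans (ler_norm _))// ltrDl.
Qed.

(** Heine-Cantor on the compact square, in the form of an open cover by the
    points around which the oscillation of k is small. *)
Lemma uniform_modulus k (e : R) : CI2 k -> 0 < e ->
  exists2 d : R, 0 < d & forall s s' t, I s -> I s' -> I t ->
    `|s - s'| < d -> normc (k s t - k s' t) <= e.
Proof.
move=> ck e0.
pose P (d : R) (p : R * R) := forall s', I s' -> `|p.1 - s'| < d ->
  normc (k p.1 p.2 - k s' p.2) <= e.
have /compact_near_coveringP/near_covering_withinP := compact_I11X.
move=> /(_ R (0 : R)^'+ P _) cov.
have {}cov : \forall d \near (0 : R)^'+, (I `*` I) `<=` P d.
  apply: cov => -[s t] [/= Is It].
  have e20 : 0 < e / 2 by rewrite divr_gt0.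
  have [r r0 rP] := CI2_epsP ck Is It e20.
  have r20 : 0 < r / 2 by rewrite divr_gt0.
  exists (ball (s, t) (r / 2), [set d | d < r / 2]).
    by split; [exact: nbhsx_ballx|exact: nbhs_right_lt].
  move=> [[u v] d] [/= [/= us vt] dr] [/= Iu Iv] s' Is' us'.
  have vt' : `|t - v| < r by apply: lt_le_trans vt _; lra.
  have us2 : `|s - u| < r by apply: lt_le_trans us _; lra.
  have ss' : `|s - s'| < r.
    by have := ler_distD u s s'; move: us us' dr; rewrite /ball/=; lra.
  have := rP u v Iu Iv us2 vt'; have := rP s' v Is' Iv ss' vt'.
  have := normcD (k u v - k s t) (k s t - k s' v).
  by rewrite addrA subrK (normcB_sym (k u v)); lra.
have [d [d0 dP]] : exists d : R, 0 < d /\ (I `*` I) `<=` P d.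
  apply: (@filter_ex _ ((0 : R)^'+)).
  by apply: filterI; [exact: nbhs_right_gt|exact: cov].
by exists d; [exact: d0|move=> s s' t Is Is' It; exact: (dP (s, t))].
Qed.

Lemma normc_cintegralM_le g h (M : R) : CI g -> CI h -> 0 <= M ->
  (forall t, I t -> normc (g t) <= M) ->
  normc (cintegral (fun t => g t * h t)) <= 4 * M * norm2 h.
Proof.
move=> cg ch M0 gM.
apply: le_trans (normc_cintegral_le (CI_M cg ch)) _.
have -> : 4 * M * norm2 h = 2 * (M * (2 * norm2 h)) by ring.
rewrite ler_pM2l//; apply: le_trans (ler_wpM2l M0 (integral_normc_le ch)).
have cN := real_CI_normc ch.
rewrite -Rintegral_I11Z//; apply: le_Rintegral_I11.
- by apply: real_CI_normc; exact: CI_M.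
- by apply: real_CI_M => //; exact: real_CI_cst.
- by move=> t It; rewrite normcM ler_wpM2r ?normc_ge0// gM.
Qed.

(** Boundedness and uniform continuity of the kernel turn into boundedness and
    equicontinuity of the images, through [normc_cintegralM_le] applied to k s
    and to k s - k t. *)
Lemma smoothing_kernel k : CI2 k ->
  smoothing (fun h s => cintegral (fun t => k s t * h t)).
Proof.
move=> ck; split.
- split=> [f g fg|a f g cf cg s Is].
    by apply/funext => s; apply: eq_cintegral => t It; rewrite fg.
  have cks := CI_section ck Is.
  rewrite -(cintegral_lin a (CI_M cks cf) (CI_M cks cg)).
  by apply: eq_cintegral => t _; ring.
- have [M M0 MP] := bounded_CI2 ck; exists (4 * M); first by rewrite mulr_ge0.
  move=> h ch s Is; apply: (normc_cintegralM_le (CI_section ck Is) ch M0).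
  by move=> t; exact: MP.
- move=> e e0; have e40 : 0 < e / 4 by rewrite divr_gt0.
  have [d d0 dP] := uniform_modulus ck e40; exists d; first exact: d0.
  move=> h ch s t Is It st.
  have cs := CI_section ck Is; have ct := CI_section ck It.
  have -> : cintegral (fun x => k s x * h x)
      - cintegral (fun x => k t x * h x) =
      cintegral (fun x => (k s x - k t x) * h x).
    rewrite addrC -mulN1r -(cintegral_lin (-1) (CI_M ct ch) (CI_M cs ch)).
    by apply: eq_cintegral => x _; ring.
  have -> : e * norm2 h = 4 * (e / 4) * norm2 h by field.
  apply: (normc_cintegralM_le (CI_B cs ct) ch (ltW e40)).
  by move=> x Ix; exact: dP.
Qed.

Lemma CI2_oscillatory (kappa : R) (K : R -> R -> R[i]) : CI2 K ->
  CI2 (fun s t => K s t * expi (kappa * `|s - t|)).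
Proof.
move=> cK p; apply: (@cvgM R[i]); first exact: cK.
suff ce : continuous (fun q : R * R =>
    expi (kappa * `|q.1 - q.2|) : R[i]^o) by exact: (continuous_subspaceT ce).
have cd : continuous (fun q : R * R => kappa * `|q.1 - q.2| : R^o).
  move=> q; apply: (@cvgM R); first exact: cvg_cst.
  apply: (@cvg_norm _ R^o); apply: (@cvgB _ R^o); first exact: cvg_fst.
  exact: cvg_snd.
apply: continuous_Complex => q.
- by apply: (continuous_comp (cd q)); exact: continuous_cos.
- by apply: (continuous_comp (cd q)); exact: continuous_sin.
Qed.

End KernelOperators.

(** * Operator norms and the bounded inverse *)

Section OperatorNorm.
Variable R : realType.
Implicit Types (f g h : R -> R[i]) (A S : (R -> R[i]) -> R -> R[i]).
Local Notation I := (@I11 R).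

Definition bounded_on_CI A : Prop :=
  exists2 C : R, 0 <= C & forall h, CI h -> norm2 (A h) <= C * norm2 h.

Lemma norm2_one_gt0 : 0 < norm2 (fun=> 1 : R[i]).
Proof.
rewrite lt_neqAle norm2_ge0 andbT eq_sym -sqrf_eq0 norm2_cst normc1.
by rewrite expr1n mulr1 pnatr_eq0.
Qed.

(** The quotients defining the operator norm leave out the functions of zero
    2-norm; on them the inequality comes from the assumed bound. *)
Lemma opnorm_bounded A : bounded_on_CI A ->
  opnorm A \is a fin_num /\
  forall h, CI h -> norm2 (A h) <= fine (opnorm A) * norm2 h.
Proof.
move=> [C C0 AC].
have leA h : CI h -> 0 < norm2 h -> ((norm2 (A h) / norm2 h)%:E <= opnorm A)%E.
  by move=> ch h0; apply: ereal_sup_ubound; exists h.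
have finA : opnorm A \is a fin_num.
  rewrite fin_numElt; apply/andP; split.
    by apply: lt_le_trans (leA _ (@CI_cst R 1) norm2_one_gt0); exact: ltNyr.
  apply: (@le_lt_trans _ _ C%:E); last exact: ltry.
  apply: ge_ereal_sup => _ [h [ch h0] <-].
  by rewrite lee_fin ler_pdivrMr// AC.
split=> // h ch; have [h0|] := ltP 0 (norm2 h).
  by rewrite -ler_pdivrMr// -lee_fin fineK// leA.
move=> h0; have {}h0 : norm2 h = 0 by apply/eqP; rewrite eq_le h0 norm2_ge0.
by have := AC h ch; rewrite h0 !mulr0.
Qed.

Lemma opnorm_ge0 A : 0 <= fine (opnorm A).
Proof.
apply: fine_ge0.
apply: (@le_trans _ _ (norm2 (A (fun=> 1)) / norm2 (fun=> 1 : R[i]))%:E).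
  by rewrite lee_fin divr_ge0 ?norm2_ge0.
by apply: ereal_sup_ubound; exists (fun=> 1) => //;
  split; [exact: CI_cst|exact: norm2_one_gt0].
Qed.

Lemma bounded_id_sub T : smoothing T -> bounded_on_CI (id_sub T).
Proof.
move=> sT; have [_ [B B0 TB] _] := sT; exists (2 + 4 * B).
  by rewrite addr_ge0// mulr_ge0.
move=> h ch; have cT := CI_smoothing sT ch.
have nT : norm2 (T h) <= 2 * (B * norm2 h).
  by apply: norm2_le_sup => //; [rewrite mulr_ge0 ?norm2_ge0|exact: TB].
have cN : CI (fun s => -1 * T h s) by apply: CI_M; [exact: CI_cst|exact: cT].
have nN : norm2 (fun s => -1 * T h s) = norm2 (T h).
  by congr Num.sqrt; apply: eq_Rintegral => t _; rewrite mulN1r normc_opp.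
have := norm2D ch cN; rewrite nN.
rewrite (@eq_norm2 _ _ (id_sub T h)) => [|s _]; last by rewrite mulN1r.
have -> : (2 + 4 * B) * norm2 h = 2 * norm2 h + 2 * (2 * (B * norm2 h)) by ring.
by lra.
Qed.

(** The solution operator S of h - T h = g is chosen pointwise in g.  It is a
    right inverse by construction, and a left inverse because S (h - T h) and h
    solve the same equation, whose solution is unique on the interval. *)
Lemma bounded_inverse_id_sub T : smoothing T -> ~ is_eigenvalue T 1 ->
  exists2 S, is_bounded_inverse (id_sub T) S & bounded_on_CI S.
Proof.
move=> sT not1.
have injT h : CI h -> (forall s, I s -> T h s = h s) ->
    forall s, I s -> h s = 0.
  move=> ch Th s Is; apply/eqP; apply: contra_notT not1 => hs0.
  by exists h; split; [exact: ch|exists s|move=> t It; rewrite mul1r Th].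
have [C C0 TC] := fredholm_alternative sT injT.
have /choice[S SP] : forall g, exists h, CI g ->
    [/\ CI h, norm2 h <= C * norm2 g & forall s, I s -> id_sub T h s = g s].
  move=> g; have [cg|ncg] := pselect (CI g); last by exists g.
  by have [h hP] := TC g cg; exists h.
have cA h : CI h -> CI (id_sub T h).
  by move=> ch; apply: CI_B; [exact: ch|exact: CI_smoothing].
have [Tl _ _] := sT.
have bS : bounded_on_CI S by exists C => // h ch; have [] := SP h ch.
exists S; last exact: bS.
split.
- by move=> h ch; split; [exact: cA|have [] := SP h ch].
- move=> h ch s Is; have [cS _ SE] := SP _ (cA h ch).
  apply/eqP; rewrite -subr_eq0; apply/eqP.
  apply: (injT (fun t => S (id_sub T h) t - h t)); [exact: CI_B| |exact: Is].
  move=> t It; rewrite (linear_onB Tl cS ch It).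
  have := SE t It; rewrite /id_sub => /eqP; rewrite subr_eq => /eqP ->.
  by ring.
- by move=> h ch; have [] := SP h ch.
- by have [] := opnorm_bounded (bounded_id_sub sT).
- by have [] := opnorm_bounded bS.
Qed.

End OperatorNorm.

(** * Continuity of the network outputs *)

Section NetworkContinuity.
Variable R : realType.
Variable sigma : R -> R.
Hypothesis csigma : continuous sigma.

Definition entrywise_continuous k (v : R -> 'cV[R]_k) : Prop :=
  forall i j, continuous ((fun s => v s i j) : R -> R^o).

Lemma entrywise_continuous_affine k k' (W : 'M[R]_(k', k)) (b : 'cV[R]_k')
    (v : R -> 'cV[R]_k) :
  entrywise_continuous v -> entrywise_continuous (fun s => W *m v s + b).
Proof.
move=> cv i j.
have -> : (fun s => (W *m v s + b) i j) =
    fun s => \sum_l W i l * v s l j + b i j.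
  by apply/funext => s; rewrite !mxE.
move=> x; apply: (@cvgD _ R^o); last exact: cvg_cst.
by apply: continuous_sum => l y; apply: (@cvgM R); [exact: cvg_cst|exact: cv].
Qed.

Lemma entrywise_continuous_conform k k' (v : R -> 'cV[R]_k) :
  entrywise_continuous v ->
  entrywise_continuous (fun s => conform_mx (0 : 'cV[R]_k') (v s)).
Proof.
move=> cv i j; have [e|ne] := eqVneq k k'.
  have -> : (fun s => conform_mx (0 : 'cV_k') (v s) i j) =
      fun s => v s (cast_ord (esym e) i) j.
    apply/funext => s; subst k'; rewrite conform_mx_id.
    by congr (v s _ j); exact: val_inj.
  exact: cv.
have -> : (fun s => conform_mx (0 : 'cV_k') (v s) i j) = fun=> 0.
  by apply/funext => s; rewrite nonconform_mx ?ne// mxE.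
by move=> x; exact: cvg_cst.
Qed.

Lemma entrywise_continuous_hidden (d : nat -> nat) (theta : params R d)
    (x : R -> 'cV[R]_(d 0)) k :
  entrywise_continuous x ->
  entrywise_continuous (fun s => hidden sigma theta (x s) k).
Proof.
move=> cx; elim: k => [//|k IH] i j.
have -> : (fun s => hidden sigma theta (x s) k.+1 i j) =
    sigma \o (fun s => ((theta k).1 *m hidden sigma theta (x s) k
                        + (theta k).2) i j).
  by apply/funext => s; rewrite /= mxE.
have ca := @entrywise_continuous_affine _ _ (theta k).1 (theta k).2 _ IH.
by move=> s; apply: (continuous_comp (ca i j s)); exact: csigma.
Qed.

Variables (n : nat -> nat) (m : nat -> nat -> nat).
Variable theta : forall l, params R (m l).

Lemma entrywise_continuous_feature l :
  entrywise_continuous (feature sigma n theta l).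
Proof.
elim: l => [|l IH] /=.
  move=> i j; rewrite (_ : (fun s => _) = id); first by move=> x; exact: cvg_id.
  by apply/funext => s; rewrite /= mxE.
by apply: entrywise_continuous_conform; exact: entrywise_continuous_hidden.
Qed.

Lemma CI_grade_output l (theta' : params R (m l.+1)) :
  CI (grade_output sigma n theta theta').
Proof.
have cN : entrywise_continuous
    (fun s => network sigma theta' (feature sigma n theta l s) (n l.+1)).
  have cf := @entrywise_continuous_feature l.
  case: (n l.+1) => [//|k] /=.
  by apply: entrywise_continuous_affine; exact: entrywise_continuous_hidden.
have cC := @entrywise_continuous_conform _ 2 _ cN.
by apply: CI_Complex; exact: cC.
Qed.

Lemma CI_ystar l : CI (ystar sigma n theta l).
Proof. by apply: CI_sum => j; exact: CI_grade_output. Qed.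

(** The last layer is affine and not activated, so zero weights and biases give
    the zero output, whatever the activation function. *)
Lemma grade_output_zero l s : (0 < n l.+1)%N ->
  grade_output sigma n theta ((fun j => (0, 0)) : params R (m l.+1)) s = 0.
Proof.
rewrite /grade_output; case: (n l.+1) => // k _ /=.
rewrite mul0mx addr0 /calT.
have -> : conform_mx (0 : 'cV[R]_2) (0 : 'cV[R]_(m l.+1 k.+1)) = 0.
  rewrite /conform_mx; case: eqP => //= e; case: eqP => //= e'.
  by subst; rewrite castmx_const.
by rewrite !mxE.
Qed.

End NetworkContinuity.

(** * The error estimate for successive grades *)

Theorem theorem1 (R : realType) (kappa : R) (K : R -> R -> R[i])
    (hkappa : 1 <= kappa) (hK : CI2 K)
    (h1 : ~ is_eigenvalue (calK kappa K) 1) :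
  exists2 S : (R -> R[i]) -> R -> R[i],
    is_bounded_inverse (id_sub (calK kappa K)) S &
    forall (f y : R -> R[i]) (sigma : R -> R)
           (L : nat) (n : nat -> nat) (m : nat -> nat -> nat)
           (theta : forall l, params R (m l)),
      CI f -> CI y ->
      (forall s, I11 s -> id_sub (calK kappa K) y s = f s) ->
      continuous sigma ->
      mgdl_architecture L n m ->
      mgdl_minimizers kappa K f sigma n theta L ->
      forall l : nat, (1 <= l < L)%N ->
        let c := fine (opnorm S) * fine (opnorm (id_sub (calK kappa K))) in
        norm2 (fun s => y s - ystar sigma n theta l.+1 s)
          <= c * norm2 (fun s => y s - ystar sigma n theta l s).
Proof.
have sT : smoothing (calK kappa K).
  exact (smoothing_kernel (@CI2_oscillatory R kappa K hK)).
have [S SP bS] := bounded_inverse_id_sub sT h1; exists S; first exact: SP.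
move=> f y sigma L n m theta cf cy yf csigma [_ arch _ _ _] minim l /andP[_ lL].
cbv zeta.
have [cAS SA _ _ _] := SP; have [Tl _ _] := sT.
pose A := id_sub (calK kappa K); pose Y := ystar sigma n theta.
have [_ SN] := opnorm_bounded bS.
have [_ AN] := opnorm_bounded (bounded_id_sub sT).
have cY j : CI (Y j) by exact: CI_ystar.
have AB j s : I11 s -> A (fun t => y t - Y j t) s = f s - A (Y j) s.
  move=> Is; rewrite -yf// /A /id_sub (linear_onB Tl cy (cY j) Is).
  by ring.
(* The two error functions compared by minimality are images under A of the
   deviations from y after and before the new grade. *)
have e_sel : norm2 (A (fun t => y t - Y l.+1 t)) =
    norm2 (grade_error kappa K f sigma n theta (theta l.+1)).
  apply: eq_norm2 => s Is; rewrite AB// /grade_error; congr (_ - id_sub _ _ s).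
  by apply/funext => t; rewrite /Y /ystar big_ord_recr.
have e_zero : norm2 (A (fun t => y t - Y l t)) =
    norm2 (grade_error kappa K f sigma n theta
             ((fun j => (0, 0)) : params R (m l.+1))).
  apply: eq_norm2 => s Is; rewrite AB// /grade_error; congr (_ - id_sub _ _ s).
  apply/funext => t; rewrite grade_output_zero ?addr0//.
  by have [] := arch l.+1 lL.
have le_e : norm2 (A (fun t => y t - Y l.+1 t)) <=
    norm2 (A (fun t => y t - Y l t)).
  have sq (a b : R) : 0 <= a -> 0 <= b -> a ^+ 2 <= b ^+ 2 -> a <= b.
    by move=> a0 b0; rewrite ler_pXn2r ?nnegrE.
  rewrite e_sel e_zero; apply: sq; [exact: norm2_ge0|exact: norm2_ge0|].
  exact: minim.
have cd j : CI (fun t => y t - Y j t) by apply: CI_B; [exact: cy|exact: cY].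
rewrite -(eq_norm2 (SA _ (cd l.+1))) -mulrA.
apply: le_trans (SN _ (cAS _ (cd l.+1)).1) _.
apply: ler_wpM2l; first exact: opnorm_ge0.
by apply: le_trans le_e _; exact: AN (cd l).
Qed.
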